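(* Let $p$ be a prime number and let $S=\{v_1,\dots,v_k\}$ be a $p$-orthonormal system in $\mathbb{Z}^4$. Then $S$ can be extended to a $p$-orthonormal base, i.e. there is a $p$-orthonormal system of exactly four vectors of $\mathbb{Z}^4$ containing $S$.
   Context: $\langle\cdot|\cdot\rangle$ is the standard inner product on $\mathbb{R}^4$ and $N(v)=\langle v|v\rangle$ is called the norm of $v$. A $p$-orthonormal system in $\mathbb{Z}^4$ is a set $S=\{v_1,\dots,v_k\}$ of vectors of $\mathbb{Z}^4$ such that $N(v_i)=p$ for all $1\le i\le k$ and $\langle v_i|v_j\rangle=0$ for all $1\le i<j\le k$. If $k=4$, $S$ is called a $p$-orthonormal base. *)

(* Defs.v *)
From mathcomp Require Import all_boot all_order all_algebra.
From mathcomp Require Import finmap.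

Set Implicit Arguments.
Unset Strict Implicit.
Unset Printing Implicit Defensive.

Import GRing.Theory.
Local Open Scope ring_scope.

Definition dotv (R : pzRingType) (n : nat) (u v : 'rV[R]_n) : R :=
  \sum_(i < n) u ord0 i * v ord0 i.

(* The norm is the squared Euclidean length. *)
Definition normv (R : pzRingType) (n : nat) (v : 'rV[R]_n) : R := dotv v v.

(* The number k of vectors of the system is the cardinal of S; S may be empty. *)
Definition orthonormal_system (p : nat) (S : {fset 'rV[int]_4}) : Prop :=
  (forall v, v \in S -> normv v = p%:Z) /\
  (forall u v, u \in S -> v \in S -> u != v -> dotv u v = 0).

Definition orthonormal_base (p : nat) (B : {fset 'rV[int]_4}) : Prop :=
  orthonormal_system p B /\ #|` B|%fset = 4%N.

(* Main.v *)
Require Import Defs.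
From mathcomp Require Import all_boot all_order all_algebra.
From mathcomp Require Import finmap.
From mathcomp Require Import ring zify.

(** Identify Z^4 with the integral quaternions, with x^* the conjugate, so that
    N(x) = x x^*. Multiplying a vector of norm [p] by the four basis quaternions
    1, i, j, k, all on the right or all on the left, gives a [p]-orthonormal
    base. It turns out that every system lies, up to signs, in a base of one of
    these two kinds.

    For two orthogonal vectors x, y of norm [p], the coordinates of x^* y and of
    y x^* are the anti-self-dual and self-dual parts of the bivector x /\ y. A
    product of a coordinate of the first by a coordinate of the second is an
    integral combination of N(x), N(y) and <x|y> ([dvdz_dual_parts]), hence is
    divisible by [p]. As [p] is prime, it divides the whole of x^* y or the whole
    of y x^*. In the first case x^* y = p u with N(u) = 1, and multiplying by x
    gives y = x u; in the second one, y = u x ([orthogonal_unit]). The integral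
    quaternions of norm 1 are the signed basis quaternions ([unit_delta]).

    Being right associates (y = x u with N(u) = 1) and being left associates
    (y = u x) are two equivalence relations which together relate any two
    members of the system. A set covered in this way is a single class of one of
    the two relations ([equivalence_cover]): an equivalence relation that is not
    total has a pair a, b outside it, which are then related by the other one,
    and so is every other element with a or b. So, for any v in the system, all
    its members are signed products of v by basis quaternions on one fixed
    side; choosing the signs of that base to agree with the system
    ([extend_signed_base]) ends the proof.

    An empty system first needs a vector of norm [p], that is, the four-square
    theorem for [p] ([prime_four_squares]), proved by Lagrange's descent from a
    solution of a^2 + b^2 + 1 = 0 modulo [p]. *)

Set Implicit Arguments.
Unset Strict Implicit.
Unset Printing Implicit Defensive.

Import Order.TTheory GRing.Theory Num.Theory.
Local Open Scope ring_scope.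

(** * The dot product *)

Section DotProduct.
Variables (R : comNzRingType) (n : nat).
Implicit Types (k : R) (x y z : 'rV[R]_n).

Lemma dotvC x y : dotv x y = dotv y x.
Proof. by apply: eq_bigr => i _; rewrite mulrC. Qed.

Lemma dotvDl x y z : dotv (x + y) z = dotv x z + dotv y z.
Proof. by rewrite -big_split; apply: eq_bigr => i _; rewrite mxE mulrDl. Qed.

Lemma dotvZl k x y : dotv (k *: x) y = k * dotv x y.
Proof. by rewrite /dotv big_distrr /=; apply: eq_bigr => i _; rewrite mxE mulrA. Qed.

Lemma dotvZr k x y : dotv x (k *: y) = k * dotv x y.
Proof. by rewrite dotvC dotvZl dotvC. Qed.

Lemma normvD x y : normv (x + y) = normv x + dotv x y *+ 2 + normv y.
Proof.
rewrite {1}/normv dotvDl !(dotvC _ (x + y)) !dotvDl (dotvC y x) -/(normv _).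
by rewrite -/(normv _) mulr2n !addrA.
Qed.

Lemma normvZ k x : normv (k *: x) = k ^+ 2 * normv x.
Proof. by rewrite /normv dotvZl dotvZr mulrA. Qed.

Lemma dotv_delta (i j : 'I_n) :
  dotv (delta_mx ord0 i) (delta_mx ord0 j) = (i == j)%:R :> R.
Proof.
rewrite /dotv (bigD1 i) //= big1 => [|k ki]; last first.
  by rewrite !mxE (negPf ki) mul0r.
by rewrite !mxE !eqxx mul1r addr0.
Qed.

End DotProduct.

(** * Quaternions *)

Section Quaternions.
Variable R : comNzRingType.
Implicit Types (a b c d : R) (x y z : 'rV[R]_4).

Definition quat a b c d : 'rV[R]_4 := \row_i [:: a; b; c; d]`_i.

(** Quaternion identities are proved by passing to coordinates with this
    eliminator, computing with [quatE], and calling [ring]. *)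
Lemma quat_elim (P : 'rV[R]_4 -> Prop) :
  (forall a b c d, P (quat a b c d)) -> forall x, P x.
Proof.
move=> Pq x.
have -> : x = quat (x ord0 (inord 0)) (x ord0 (inord 1))
                   (x ord0 (inord 2)) (x ord0 (inord 3)).
  apply/rowP => i; rewrite mxE; case: i => [[|[|[|[|//]]]] lti] /=;
    by congr (x _ _); apply: val_inj; rewrite /= inordK.
exact: Pq.
Qed.

Definition qmul x y : 'rV[R]_4 :=
  let: (a, b, c, d) :=
    (x ord0 (inord 0), x ord0 (inord 1), x ord0 (inord 2), x ord0 (inord 3)) in
  let: (a', b', c', d') :=
    (y ord0 (inord 0), y ord0 (inord 1), y ord0 (inord 2), y ord0 (inord 3)) in
  quat (a * a' - b * b' - c * c' - d * d')
       (a * b' + b * a' + c * d' - d * c')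
       (a * c' + c * a' + d * b' - b * d')
       (a * d' + d * a' + b * c' - c * b').

Definition qconj x : 'rV[R]_4 :=
  quat (x ord0 (inord 0)) (- x ord0 (inord 1))
       (- x ord0 (inord 2)) (- x ord0 (inord 3)).

Definition qone : 'rV[R]_4 := quat 1 0 0 0.

Lemma qmulE a b c d a' b' c' d' :
  qmul (quat a b c d) (quat a' b' c' d') =
  quat (a * a' - b * b' - c * c' - d * d')
       (a * b' + b * a' + c * d' - d * c')
       (a * c' + c * a' + d * b' - b * d')
       (a * d' + d * a' + b * c' - c * b').
Proof. by rewrite /qmul !mxE !inordK. Qed.

Lemma qconjE a b c d : qconj (quat a b c d) = quat a (- b) (- c) (- d).
Proof. by rewrite /qconj !mxE !inordK. Qed.

Lemma dotvE a b c d a' b' c' d' :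
  dotv (quat a b c d) (quat a' b' c' d') = a * a' + b * b' + c * c' + d * d'.
Proof.
by rewrite /dotv !big_ord_recr big_ord0 /= !mxE /= add0r.
Qed.

Lemma quatD a b c d a' b' c' d' :
  quat a b c d + quat a' b' c' d' = quat (a + a') (b + b') (c + c') (d + d').
Proof. by apply/rowP => [[[|[|[|[|//]]]] lti]]; rewrite !mxE. Qed.

Lemma quatZ k a b c d : k *: quat a b c d = quat (k * a) (k * b) (k * c) (k * d).
Proof. by apply/rowP => [[[|[|[|[|//]]]] lti]]; rewrite !mxE. Qed.

Definition quatE := (qmulE, qconjE, dotvE, quatD, quatZ).

Lemma qmulA x y z : qmul x (qmul y z) = qmul (qmul x y) z.
Proof.
elim/quat_elim: x => a b c d; elim/quat_elim: y => a' b' c' d'.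
elim/quat_elim: z => a'' b'' c'' d''; rewrite !quatE; congr quat; ring.
Qed.

Lemma qmulx1 x : qmul x qone = x.
Proof. elim/quat_elim: x => a b c d; rewrite !quatE; congr quat; ring. Qed.

Lemma qmul1x x : qmul qone x = x.
Proof. elim/quat_elim: x => a b c d; rewrite !quatE; congr quat; ring. Qed.

Lemma qmulDl x y z : qmul (x + y) z = qmul x z + qmul y z.
Proof.
elim/quat_elim: x => a b c d; elim/quat_elim: y => a' b' c' d'.
elim/quat_elim: z => a'' b'' c'' d''; rewrite !quatE; congr quat; ring.
Qed.

Lemma qmulZl k x y : qmul (k *: x) y = k *: qmul x y.
Proof.
elim/quat_elim: x => a b c d; elim/quat_elim: y => a' b' c' d'.
rewrite !quatE; congr quat; ring.
Qed.

Lemma qmulZr k x y : qmul x (k *: y) = k *: qmul x y.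
Proof.
elim/quat_elim: x => a b c d; elim/quat_elim: y => a' b' c' d'.
rewrite !quatE; congr quat; ring.
Qed.

Lemma qmulxC x : qmul x (qconj x) = normv x *: qone.
Proof.
elim/quat_elim: x => a b c d; rewrite /normv !quatE; congr quat; ring.
Qed.

Lemma qmulCx x : qmul (qconj x) x = normv x *: qone.
Proof.
elim/quat_elim: x => a b c d; rewrite /normv !quatE; congr quat; ring.
Qed.

Lemma dotv_qmul2l x y z : dotv (qmul x y) (qmul x z) = normv x * dotv y z.
Proof.
elim/quat_elim: x => a b c d; elim/quat_elim: y => a' b' c' d'.
elim/quat_elim: z => a'' b'' c'' d''; rewrite /normv !quatE; ring.
Qed.

Lemma dotv_qmul2r x y z : dotv (qmul y x) (qmul z x) = normv x * dotv y z.
Proof.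
elim/quat_elim: x => a b c d; elim/quat_elim: y => a' b' c' d'.
elim/quat_elim: z => a'' b'' c'' d''; rewrite /normv !quatE; ring.
Qed.

Lemma normv_qmul x y : normv (qmul x y) = normv x * normv y.
Proof. by rewrite {1}/normv dotv_qmul2l. Qed.

Lemma normv_conj x : normv (qconj x) = normv x.
Proof. elim/quat_elim: x => a b c d; rewrite /normv !quatE; ring. Qed.

Lemma normv1 : normv qone = 1.
Proof. rewrite /normv !quatE; ring. Qed.

End Quaternions.

(** * Integral quaternions of norm one *)

Lemma normvN (x : 'rV[int]_4) : normv (- x) = normv x.
Proof. by rewrite -scaleN1r normvZ sqrrN mul1r. Qed.

Lemma normv_delta (i : 'I_4) : normv (delta_mx ord0 i : 'rV[int]_4) = 1.
Proof. by rewrite /normv dotv_delta eqxx. Qed.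

(** A nonzero coordinate already has square at least 1, which leaves nothing for
    the other ones. *)
Lemma unit_delta (n : nat) (u : 'rV[int]_n) :
  normv u = 1 -> exists i, u = delta_mx ord0 i \/ u = - delta_mx ord0 i.
Proof.
move=> Nu; have [u0 | [i ui]] : u = 0 \/ exists i, u ord0 i != 0.
    case: (pickP (fun i => u ord0 i != 0)) => [i ui | u0]; [right; by exists i|].
    by left; apply/rowP => i; rewrite mxE; apply/eqP; rewrite -[_ == _]negbK u0.
  by move: Nu; rewrite u0 /normv /dotv big1 // => i _; rewrite mxE mul0r.
move: Nu; rewrite /normv /dotv (bigD1 i) //=.
set r := \sum_(j | _) _ => Nu.
have r_ge0 : 0 <= r by apply: sumr_ge0 => j _; rewrite -expr2 sqr_ge0.
have [ui2 r0] : u ord0 i * u ord0 i = 1 /\ r = 0 by nia.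
have uj j : j != i -> u ord0 j = 0.
  move=> ji; have /eqP := r0; rewrite psumr_eq0 => [/allP/(_ j)|k _].
    by rewrite mem_index_enum ji => /(_ isT); rewrite mulf_eq0 orbb => /eqP.
  by rewrite -expr2 sqr_ge0.
exists i; have [e | e] : u ord0 i = 1 \/ u ord0 i = -1 by nia.
- left; apply/rowP => j; rewrite !mxE eqxx.
  by case: eqVneq => [->|/uj->]; rewrite ?e.
right; apply/rowP => j; rewrite !mxE eqxx.
by case: eqVneq => [->|/uj->]; rewrite ?e ?oppr0.
Qed.

Lemma qmulN1r (x y : 'rV[int]_4) : qmul x (- y) = - qmul x y.
Proof. by rewrite -scaleN1r qmulZr scaleN1r. Qed.

Lemma qmulN1l (x y : 'rV[int]_4) : qmul (- x) y = - qmul x y.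
Proof. by rewrite -scaleN1r qmulZl scaleN1r. Qed.

(** The unit quaternions are enumerated so that the relation is decidable; they are
    recovered as the quaternions of norm 1 in [right_assocP]. *)
Definition right_assoc : rel 'rV[int]_4 := fun x y =>
  [exists i, (y == qmul x (delta_mx ord0 i))
          || (y == - qmul x (delta_mx ord0 i))].

Definition left_assoc : rel 'rV[int]_4 := fun x y =>
  [exists i, (y == qmul (delta_mx ord0 i) x)
          || (y == - qmul (delta_mx ord0 i) x)].

Lemma right_assocP x y :
  reflect (exists2 u, normv u = 1 & y = qmul x u) (right_assoc x y).
Proof.
apply: (iffP existsP) => [[i /orP[] /eqP->] | [u Nu ->]].
- by exists (delta_mx ord0 i); rewrite ?normv_delta.
- by exists (- delta_mx ord0 i); rewrite ?qmulN1r ?normvN ?normv_delta.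
by have [i [->|->]] := unit_delta Nu; exists i; rewrite ?qmulN1r eqxx ?orbT.
Qed.

Lemma left_assocP x y :
  reflect (exists2 u, normv u = 1 & y = qmul u x) (left_assoc x y).
Proof.
apply: (iffP existsP) => [[i /orP[] /eqP->] | [u Nu ->]].
- by exists (delta_mx ord0 i); rewrite ?normv_delta.
- by exists (- delta_mx ord0 i); rewrite ?qmulN1l ?normvN ?normv_delta.
by have [i [->|->]] := unit_delta Nu; exists i; rewrite ?qmulN1l eqxx ?orbT.
Qed.

Lemma right_assoc_refl : reflexive right_assoc.
Proof.
by move=> x; apply/right_assocP; exists (qone _); rewrite ?normv1 ?qmulx1.
Qed.

Lemma right_assoc_trans : transitive right_assoc.
Proof.
move=> y x z /right_assocP[u Nu ->] /right_assocP[v Nv ->].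
apply/right_assocP; exists (qmul u v); last by rewrite qmulA.
by rewrite normv_qmul Nu Nv.
Qed.

Lemma left_assoc_trans : transitive left_assoc.
Proof.
move=> y x z /left_assocP[u Nu ->] /left_assocP[v Nv ->].
apply/left_assocP; exists (qmul v u); last by rewrite qmulA.
by rewrite normv_qmul Nu Nv.
Qed.

Lemma left_assoc_sym x y : left_assoc x y -> left_assoc y x.
Proof.
move=> /left_assocP[u Nu ->]; apply/left_assocP; exists (qconj u).
  by rewrite normv_conj.
by rewrite qmulA qmulCx Nu scale1r qmul1x.
Qed.

(** * Orthogonal vectors of prime norm are associates *)

Lemma dvd_rVP (n : nat) (d : int) (x : 'rV[int]_n) :
  (forall i, (d %| x ord0 i)%Z) <-> exists u, x = d *: u.
Proof.
split=> [dx | [u -> i]]; last by rewrite mxE dvdz_mulr.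
exists (\row_i (x ord0 i %/ d)%Z); apply/rowP => i.
by rewrite !mxE mulrC divzK.
Qed.

Section PrimeNorm.
Variable p : nat.
Hypothesis p_pr : prime p.
Local Notation pz := (p%:Z).

Lemma Euclid_dvdzM (m n : int) : (pz %| m * n)%Z = (pz %| m)%Z || (pz %| n)%Z.
Proof. by rewrite !dvdzE abszM Euclid_dvdM. Qed.

(** If [x] and [y] were both nonzero modulo the prime [p], so would be the product
    of a nonzero coordinate of each. *)
Lemma dvdz_tensor (n : nat) (x y : 'rV[int]_n) :
    (forall i j, (pz %| x ord0 i * y ord0 j)%Z) ->
  (exists u, x = pz *: u) \/ (exists u, y = pz *: u).
Proof.
move=> dxy; case: (boolP [forall i, (pz %| x ord0 i)%Z]) => [/forallP dx | ].
  by left; apply/dvd_rVP.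
rewrite negb_forall => /existsP[i ndxi]; right; apply/dvd_rVP => j.
by have := dxy i j; rewrite Euclid_dvdzM (negPf ndxi).
Qed.

(** The antisymmetric matrix W of the Pluecker coordinates of a /\ b satisfies
    W W^T = N(b) a a^T + N(a) b b^T - <a|b> (a b^T + b a^T), so its entries are
    divisible by [p]. A product of an anti-self-dual coordinate of W by a
    self-dual one is a signed sum of two entries of W W^T, up to correcting
    terms divisible by [p] when the two coordinates have the same index. The
    remaining products are obtained by permuting the indices 1, 2, 3
    cyclically. *)
Lemma dvdz_dual_parts (a0 a1 a2 a3 b0 b1 b2 b3 : int) :
    a0 * a0 + a1 * a1 + a2 * a2 + a3 * a3 = pz ->
    b0 * b0 + b1 * b1 + b2 * b2 + b3 * b3 = pz ->
    a0 * b0 + a1 * b1 + a2 * b2 + a3 * b3 = 0 ->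
  let w01 := a0 * b1 - a1 * b0 in let w23 := a2 * b3 - a3 * b2 in
  let w02 := a0 * b2 - a2 * b0 in let w31 := a3 * b1 - a1 * b3 in
  let w03 := a0 * b3 - a3 * b0 in let w12 := a1 * b2 - a2 * b1 in
  [/\ (pz %| (w01 - w23) * (w01 + w23))%Z,
      (pz %| (w01 - w23) * (w02 + w31))%Z
    & (pz %| (w01 - w23) * (w03 + w12))%Z].
Proof.
move=> Na Nb Dab w01 w23 w02 w31 w03 w12.
(* [gram ai aj bi bj] is the entry of index (i, j) of W W^T. *)
pose gram i j k l := (b0 * b0 + b1 * b1 + b2 * b2 + b3 * b3) * (i * j)
  + (a0 * a0 + a1 * a1 + a2 * a2 + a3 * a3) * (k * l)
  - (a0 * b0 + a1 * b1 + a2 * b2 + a3 * b3) * (i * l + k * j).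
have gram_dvd i j k l : (pz %| gram i j k l)%Z.
  by rewrite /gram Na Nb Dab mul0r subr0 rpredD ?dvdz_mulr.
split.
- (* Halving T00 + T11 - T22 - T33, where T = W W^T, would lose a factor 2 at
     p = 2; replacing T22 and T33 by means of the trace avoids the division. *)
  have -> : (w01 - w23) * (w01 + w23) =
    gram a0 a0 b0 b0 + gram a1 a1 b1 b1
    + (a0 * b0 + a1 * b1 + a2 * b2 + a3 * b3) ^+ 2
    - (a0 * a0 + a1 * a1 + a2 * a2 + a3 * a3)
      * (b0 * b0 + b1 * b1 + b2 * b2 + b3 * b3).
    by rewrite /gram /w01 /w23; ring.
  by rewrite Na Nb Dab expr0n addr0 rpredB ?(dvdz_mulr _ (dvdzz pz)) //
    rpredD ?gram_dvd.
- have -> : (w01 - w23) * (w02 + w31) = gram a1 a2 b1 b2 + gram a0 a3 b0 b3.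
    by rewrite /gram /w01 /w23 /w02 /w31; ring.
  by rewrite rpredD.
- have -> : (w01 - w23) * (w03 + w12) = gram a1 a3 b1 b3 - gram a0 a2 b0 b2.
    by rewrite /gram /w01 /w23 /w03 /w12; ring.
  by rewrite rpredB.
Qed.

Lemma orthogonal_qmul_dvd (x y : 'rV[int]_4) :
    normv x = pz -> normv y = pz -> dotv x y = 0 ->
  (exists u, qmul (qconj x) y = pz *: u) \/
  (exists u, qmul y (qconj x) = pz *: u).
Proof.
elim/quat_elim: x => a0 a1 a2 a3; elim/quat_elim: y => b0 b1 b2 b3.
rewrite /normv !dotvE => Na Nb Dab.
have [d11 d12 d13] := dvdz_dual_parts Na Nb Dab.
have [|||d22 d23 d21] := @dvdz_dual_parts a0 a2 a3 a1 b0 b2 b3 b1.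
- by rewrite -Na; ring.
- by rewrite -Nb; ring.
- by rewrite -Dab; ring.
have [|||d33 d31 d32] := @dvdz_dual_parts a0 a3 a1 a2 b0 b3 b1 b2.
- by rewrite -Na; ring.
- by rewrite -Nb; ring.
- by rewrite -Dab; ring.
pose w01 := a0 * b1 - a1 * b0; pose w23 := a2 * b3 - a3 * b2.
pose w02 := a0 * b2 - a2 * b0; pose w31 := a3 * b1 - a1 * b3.
pose w03 := a0 * b3 - a3 * b0; pose w12 := a1 * b2 - a2 * b1.
(* The real parts are both <x|y> = 0. *)
have left_part : qmul (qconj (quat a0 a1 a2 a3)) (quat b0 b1 b2 b3) =
    quat 0 (w01 - w23) (w02 - w31) (w03 - w12).
  by rewrite !quatE -Dab /w01 /w02 /w03 /w12 /w23 /w31; congr quat; ring.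
have right_part : qmul (quat b0 b1 b2 b3) (qconj (quat a0 a1 a2 a3)) =
    quat 0 (w01 + w23) (w02 + w31) (w03 + w12).
  by rewrite !quatE -Dab /w01 /w02 /w03 /w12 /w23 /w31; congr quat; ring.
rewrite left_part right_part; apply: dvdz_tensor => i j; rewrite !mxE.
case: i => [[|[|[|[|//]]]] lti] /=; rewrite ?mul0r ?dvdz0 //;
  by case: j => [[|[|[|[|//]]]] ltj] /=; rewrite ?mulr0 ?dvdz0.
Qed.

(** Once x^* y = p u, multiplicativity of the norm gives N(u) = 1, and
    multiplying by x on the left turns the equation into p y = p x u. *)
Lemma orthogonal_unit (x y : 'rV[int]_4) :
    normv x = pz -> normv y = pz -> dotv x y = 0 ->
  right_assoc x y || left_assoc x y.
Proof.
move=> Nx Ny Dxy; have p_neq0 : pz != 0 by rewrite eqz_nat -lt0n prime_gt0.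
have unit_norm (u : 'rV[int]_4) : normv (pz *: u) = pz * pz -> normv u = 1.
  by rewrite normvZ expr2 -{2}[pz * pz]mulr1 => /mulfI-> //; rewrite mulf_neq0.
have scale_inj (u w : 'rV[int]_4) : pz *: u = pz *: w -> u = w.
  move=> e; apply/rowP => i; have /rowP/(_ i) := e.
  by rewrite !mxE => /(mulfI p_neq0).
case: (orthogonal_qmul_dvd Nx Ny Dxy) =>  [] [u Eu]; apply/orP;
  [left; apply/right_assocP | right; apply/left_assocP]; exists u.
- by apply: unit_norm; rewrite -Eu normv_qmul normv_conj Nx Ny.
- apply: scale_inj.
  by rewrite -qmulZr -Eu qmulA qmulxC Nx qmulZl qmul1x.
- by apply: unit_norm; rewrite -Eu normv_qmul normv_conj Nx Ny.
apply: scale_inj.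
by rewrite -qmulZl -Eu -qmulA qmulCx Nx qmulZr qmulx1.
Qed.

(** * Vectors of norm p *)

(** There are [p./2.+1] squares of integers at most [p./2] and as many integers
    -(y^2 + 1), more than [p] in total, so two of them agree modulo [p]. Two of
    the same kind cannot, since x^2 - y^2 = (x - y) (x + y) and both factors are
    less than [p] in absolute value. The bounds on the solution make the quotient
    of a^2 + b^2 + 1 by [p] less than [p], where the descent starts. *)
Lemma two_squares_mod :
  exists x y : nat, [/\ (x.*2 <= p)%N, (y.*2 <= p)%N & (p %| x ^ 2 + y ^ 2 + 1)%N].
Proof.
have p_gt1 := prime_gt1 p_pr.
pose f (t : 'I_(p./2).+1 + 'I_(p./2).+1) : 'F_p :=
  match t with inl x => (x%:Z ^+ 2)%:~R | inr y => (- (y%:Z ^+ 2 + 1))%:~R end.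
have f_eq (m n : int) : m%:~R = n%:~R :> 'F_p -> (pz %| m - n)%Z.
  by move=> e; rewrite (dvdz_pcharf (pchar_Fp p_pr)) rmorphB /= e subrr.
have sq_inj (i j : 'I_(p./2).+1) : (pz %| i%:Z ^+ 2 - j%:Z ^+ 2)%Z -> i = j.
  have [li lj] := (ltn_ord i, ltn_ord j).
  rewrite subr_sqr Euclid_dvdzM => dij; apply/val_inj/eqP => /=.
  apply: contraLR dij => neq_ij; rewrite !dvdzE negb_or.
  by rewrite !gtnNdvd ?absz_nat //; lia.
have : ~~ injectiveb f.
  apply/negP => /injectiveP/leq_card; rewrite card_sum card_ord card_Fp //.
  by move: p_gt1; lia.
have bound (i : 'I_(p./2).+1) : (i.*2 <= p)%N by have := ltn_ord i; lia.
have conclude (i j : 'I_(p./2).+1) : (pz %| i%:Z ^+ 2 + j%:Z ^+ 2 + 1)%Z ->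
  exists x y : nat, [/\ (x.*2 <= p)%N, (y.*2 <= p)%N & (p %| x ^ 2 + y ^ 2 + 1)%N].
  by move=> dij; exists i, j; split; rewrite ?bound //.
case/injectivePn => [[i|i] [[j|j]]] neq_ij /f_eq dij.
- by case/eqP: neq_ij; rewrite (sq_inj _ _ dij).
- by apply: (conclude i j); rewrite opprK addrA in dij.
- apply: (conclude i j); move: dij.
  by rewrite -opprD dvdzE abszN -dvdzE addrAC.
- case/eqP: neq_ij; rewrite (sq_inj j i) //.
  by move: dij; congr (_ %| _)%Z; ring.
Qed.

Lemma centered_residue (m x : int) : 0 < m ->
  exists c : int, 4 * (x - m * c) ^+ 2 <= m ^+ 2.
Proof.
move=> m_gt0; have := divz_eq x m; have := ltz_pmod x m_gt0.
have := modz_ge0 x (lt0r_neq0 m_gt0).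
set q := (x %/ m)%Z; set r := (x %% m)%Z => r_ge0 r_lt ->.
have [r_le | r_gt] := lerP (2 * r) m.
  exists q; have -> : q * m + r - m * q = r by ring.
  by nia.
exists (q + 1); have -> : q * m + r - m * (q + 1) = r - m by ring.
by nia.
Qed.

(** Lagrange's descent. Reduce the coordinates of [x] modulo [m] to a vector [y] with
    coordinates at most m / 2 in absolute value. Then N(y) is a multiple m r with
    r <= m, and x y^* = N(y) = 0 modulo [m]; the quotient x y^* / m has norm r p.
    In both extreme cases r = 0 and r = m, every coordinate of 2 y is divisible
    by [m] and N(y) by m^2, so that m^2 divides N(x) = m p, which is impossible
    as [p] is prime. *)
Lemma normv_descent (m : nat) (x : 'rV[int]_4) :
  (1 < m < p)%N -> normv x = m%:Z * pz ->
  exists r : nat, (0 < r < m)%N /\ exists x' : 'rV[int]_4, normv x' = r%:Z * pz.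
Proof.
case/andP=> m_gt1 m_ltp Nx; have m_gt0 : 0 < m%:Z by lia.
have m_neq0 : m%:Z != 0 by lia.
have /fin_all_exists[c0 c0P] i := centered_residue (x ord0 i) m_gt0.
pose c : 'rV[int]_4 := \row_i c0 i; pose y := x - m%:Z *: c.
have y_small i : 4 * (y ord0 i * y ord0 i) <= m%:Z ^+ 2.
  by have := c0P i; rewrite !mxE expr2.
have x_def : x = m%:Z *: c + y by rewrite addrC subrK.
have Nx_expand : normv x =
    m%:Z ^+ 2 * normv c + (m%:Z * dotv c y) *+ 2 + normv y.
  by rewrite x_def normvD normvZ dotvZl.
have [r Ny] : exists r, normv y = m%:Z * r.
  exists (pz - m%:Z * normv c - dotv c y *+ 2).
  have -> : normv y = normv x - m%:Z ^+ 2 * normv c - (m%:Z * dotv c y) *+ 2.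
    by rewrite Nx_expand; ring.
  by rewrite Nx; ring.
pose x' := qmul c (qconj y) + r *: qone _.
have x'_def : qmul x (qconj y) = m%:Z *: x'.
  by rewrite {1}x_def qmulDl qmulZl qmulxC Ny -scalerA scalerDr.
have Nx' : normv x' = r * pz.
  apply: (@mulfI _ (m%:Z ^+ 2)); first by rewrite expf_neq0.
  by rewrite -normvZ -x'_def normv_qmul normv_conj Nx Ny; ring.
(* Each term is nonnegative: the sum gives r <= m, and if r = m then every
   coordinate of 2 y is m or - m. *)
have sum_gap : \sum_(i < 4) (m%:Z ^+ 2 - 4 * (y ord0 i * y ord0 i)) =
    4 * (m%:Z * (m%:Z - r)).
  rewrite sumrB sumr_const card_ord -mulr_sumr -/(dotv y y) -/(normv y) Ny.
  by ring.
have gap_ge0 i : 0 <= m%:Z ^+ 2 - 4 * (y ord0 i * y ord0 i).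
  by rewrite subr_ge0.
have r_le : r <= m%:Z.
  have : 0 <= 4 * (m%:Z * (m%:Z - r)) by rewrite -sum_gap sumr_ge0.
  by rewrite !pmulr_rge0 // subr_ge0.
have r_ge0 : 0 <= r.
  rewrite -(pmulr_rge0 _ m_gt0) -Ny sumr_ge0 // => i _.
  by rewrite -expr2 sqr_ge0.
have not_dvd : ~ (m%:Z %| pz)%Z.
  rewrite dvdzE !absz_nat => /(prime_nt_dvdP p_pr)-/(_ _).
  by lia.
have nondegenerate : ~ ((forall i, (m%:Z %| y ord0 i *+ 2)%Z) /\ (m%:Z %| r)%Z).
  case=> dy dr; have dvd_dot : (m%:Z %| dotv c y *+ 2)%Z.
    by rewrite /dotv -sumrMnl rpred_sum // => i _; rewrite -mulrnAr dvdz_mull.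
  apply: not_dvd; rewrite -(dvdz_mul2l m_neq0) -Nx.
  have -> : normv x = m%:Z * (m%:Z * normv c + dotv c y *+ 2 + r).
    by rewrite Nx_expand Ny; ring.
  by rewrite dvdz_mul2l // rpredD ?dr // rpredD ?dvd_dot // dvdz_mulr ?dvdzz.
exists `|r|%N; split; last by exists x'; rewrite Nx' gez0_abs.
have r_neq0 : r <> 0.
  move=> r0; apply: nondegenerate; rewrite r0 dvdz0; split=> // i.
  have /eqP := Ny; rewrite r0 mulr0 psumr_eq0 => [/allP/(_ i)|k _].
    by rewrite mem_index_enum mulf_eq0 orbb => /(_ isT)/eqP->; rewrite mul0rn dvdz0.
  by rewrite -expr2 sqr_ge0.
have r_neqm : r <> m%:Z.
  move=> rm; apply: nondegenerate; rewrite rm dvdzz; split=> // i.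
  have /eqP := sum_gap; rewrite rm subrr !mulr0 psumr_eq0 // => /allP/(_ i).
  rewrite mem_index_enum subr_eq0 => /(_ isT)/eqP e.
  have : (y ord0 i *+ 2) ^+ 2 == m%:Z ^+ 2 by apply/eqP; rewrite e; ring.
  by rewrite eqf_sqr => /orP[]/eqP->; rewrite ?rpredN dvdzz.
by lia.
Qed.

Lemma prime_four_squares : exists x : 'rV[int]_4, normv x = pz.
Proof.
have [a [b [a_le b_le /dvdnP[k kP]]]] := two_squares_mod.
have p_gt1 := prime_gt1 p_pr.
have k_lt : (k < p)%N by nia.
have k_gt0 : (0 < k)%N by case: k kP {k_lt} => // /eqP; rewrite addn1.
have : normv (quat 1 a%:Z b%:Z 0) = k%:Z * pz.
  rewrite /normv dotvE -PoszM -kP; lia.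
move: (quat _ _ _ _) => {a b a_le b_le kP} x.
elim/ltn_ind: k x k_lt k_gt0 => k IHk x k_lt k_gt0 Nx.
have [k1 | k_neq1] := eqVneq k 1%N; first by exists x; rewrite Nx k1 mul1r.
have [|r [/andP[r_gt0 r_lt] [x' Nx']]] := normv_descent _ Nx.
  by rewrite k_lt andbT; lia.
exact: IHk r_lt x' (ltn_trans r_lt k_lt) r_gt0 Nx'.
Qed.

End PrimeNorm.

(** * Extension of orthonormal systems *)

(** If [b] is not in the [R]-class of [a], then [a] and [b] are [L]-related; an [x]
    which is [R]-related to [a] cannot be so to [b], hence it is [L]-related to
    [b], and thus to [a]. *)
Lemma equivalence_cover (T : eqType) (R L : rel T) (s : seq T) (a : T) :
    transitive R -> transitive L -> (forall x y, L x y -> L y x) ->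
    {in s &, forall x y, R x y || L x y} -> a \in s ->
  {in s, forall x, R a x} \/ {in s, forall x, L a x}.
Proof.
move=> Rtr Ltr Lsym RL a_s; case: (boolP (all (R a) s)) => [/allP|]; first by left.
case/allPn => b b_s nRab; have := RL _ _ a_s b_s; rewrite (negPf nRab) => Lab.
right=> x x_s; case/orP: (RL _ _ a_s x_s) => // Rax.
case/orP: (RL _ _ x_s b_s) => [Rxb | Lxb]; first by rewrite (Rtr _ _ _ Rax Rxb) in nRab.
by apply: Ltr Lab _; apply: Lsym.
Qed.

(** The base is [f] with the sign of [f i] reversed when [- f i] is the one in [S];
    [S] cannot contain both, as they are not orthogonal. *)
Lemma extend_signed_base (p : nat) (S : {fset 'rV[int]_4})
    (f : 'I_4 -> 'rV[int]_4) :
    (0 < p)%N -> orthonormal_system p S ->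
    (forall i j, dotv (f i) (f j) = p%:Z * (i == j)%:R) ->
    (forall v, v \in S -> exists i, v = f i \/ v = - f i) ->
  exists B : {fset 'rV[int]_4}, orthonormal_base p B /\ (S `<=` B)%fset.
Proof.
move=> p_gt0 [NS oS] Df Sf.
pose g i := (-1) ^+ (- f i \in S) *: f i.
have Dg i j : dotv (g i) (g j) = p%:Z * (i == j)%:R.
  rewrite dotvZl dotvZr Df; case: eqVneq => [-> | _]; last by rewrite !mulr0.
  by rewrite mulrA -expr2 sqrr_sign mul1r.
have g_inj : injective g.
  move=> i j gij; have := Dg i j; rewrite gij Dg eqxx.
  by case: eqVneq => // _ /eqP; rewrite mulr1 mulr0 eqz_nat eqn0Ngt p_gt0.
exists [fset g i | i : 'I_4]%fset; split; [split; [split |] |].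
- by move=> v /imfsetP[i _ ->]; rewrite /normv Dg eqxx mulr1.
- move=> u v /imfsetP[i _ ->] /imfsetP[j _ ->] gij; rewrite Dg.
  by case: (eqVneq i j) gij => [-> | _ _]; rewrite ?eqxx ?mulr0.
- by rewrite card_imfset //= -cardE card_ord.
apply/fsubsetP => v vS; have [i [vfi|vfi]] := Sf v vS; apply/imfsetP; exists i => //.
- rewrite /g; case: (boolP (_ \in S)) => [NvS|_]; last by rewrite scale1r.
  have fi_neq : f i != - f i.
    apply/eqP=> fN; have := Df i i; rewrite {2}fN -scaleN1r dotvZr Df eqxx.
    by move: p_gt0 => /[swap]; lia.
  have := oS _ _ vS NvS; rewrite vfi -scaleN1r dotvZr Df eqxx scaleN1r => /(_ fi_neq).
  by move: p_gt0 => /[swap]; lia.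
by rewrite /g -vfi vS scaleN1r.
Qed.

Theorem theorem3p11 (p : nat) (S : {fset 'rV[int]_4}) :
  prime p -> orthonormal_system p S ->
  exists B : {fset 'rV[int]_4}, orthonormal_base p B /\ (S `<=` B)%fset.
Proof.
move=> p_pr orthS; have [NS oS] := orthS.
have extend := extend_signed_base (prime_gt0 p_pr) orthS.
case: (fset_0Vmem S) => [S0 | [v vS]].
  have [v Nv] := prime_four_squares p_pr.
  apply: (extend (fun i => qmul v (delta_mx ord0 i))) => [i j | w].
    by rewrite dotv_qmul2l Nv dotv_delta.
  by rewrite S0 in_fset0.
have assocS : {in S &, forall x y, right_assoc x y || left_assoc x y}.
  move=> x y xS yS; case: (eqVneq x y) => [-> | neq_xy].
    by rewrite right_assoc_refl.
  by apply: (orthogonal_unit p_pr); rewrite ?NS ?oS.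
have [right_v | left_v] := equivalence_cover right_assoc_trans left_assoc_trans
  left_assoc_sym assocS vS.
- apply: (extend (fun i => qmul v (delta_mx ord0 i))) => [i j | w wS].
    by rewrite dotv_qmul2l NS // dotv_delta.
  by case/existsP: (right_v w wS) => i /orP[] /eqP->; exists i; [left | right].
- apply: (extend (fun i => qmul (delta_mx ord0 i) v)) => [i j | w wS].
    by rewrite dotv_qmul2r NS // dotv_delta.
  by case/existsP: (left_v w wS) => i /orP[] /eqP->; exists i; [left | right].
Qed.
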